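(* Let $F_n$ be the free group on $n\ge 2$ generators. Let $P=\{H_i\alpha_i\}_{i=1}^{s}$ be a coset partition of $F_n$ with $H_i<F_n$ of index $d_i$, $\alpha_i\in F_n$, $1\le i\le s$, and $1<d_1\le\dots\le d_s$. Let $\tilde X_i$ denote the Schreier graph of $H_i$, with transition matrix $A_i$ of period $h_i\ge 1$, $1\le i\le s$. Assume $h>1$, where $h=\max\{h_i\mid 1\le i\le s\}$. Let $J=\{j\mid 1\le j\le s,\ h_j=h\}$, let $\omega=e^{2\pi i/h}$, and for each $j\in J$ let $m_j$ be the minimal length of a directed path in $\tilde X_j$ from the vertex $H_j$ to the vertex $H_j\alpha_j$. Then $P$ induces a vanishing sum of roots of unity of order $h$: \[\sum_{j\in J}\Big(\prod_{\substack{i\in J\\ i\ne j}}d_i\Big)\,\omega^{m_j}=0 .\] Furthermore, $P$ induces a (non-empty) set of irreducible vanishing sums of roots of unity of order $h$ of the following form, where $J'\subseteq J$: \[\sum_{j\in J'}\Big(\prod_{\substack{i\in J'\\ i\ne j}}d_i\Big)\,\omega^{m_j}=0 .\] To each irreducible sum there is associated a convex polygon $\mathcal P$ with $|J'|$ sides.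
   Context: Let $F_n$ be freely generated by $\Sigma$, $|\Sigma|=n$. A coset partition of a group $G$ is a finite family $\{H_i\alpha_i\}_{i=1}^{s}$ of right cosets of finite-index subgroups $H_i$ ($\alpha_i\in G$) that are pairwise disjoint and have union $G$. Schreier graph: for $H<F_n$ of finite index $d$, $\tilde X_H$ is the directed labelled graph whose $d$ vertices are the right cosets of $H$, with one edge $Hg\xrightarrow{a}Hga$ for each coset $Hg$ and each $a\in\Sigma$ (only positive generators, not inverses). It is strongly connected. Its transition matrix $A$ is the $d\times d$ matrix whose $(i,j)$ entry is the number of directed edges from vertex $i$ to vertex $j$; it is a non-negative irreducible matrix. The period of $A$ is the gcd of all $m\in\mathbb Z^+$ with $(A^m)_{ii}>0$ (independent of $i$). The minimal length of a directed path from a vertex to itself is $0$ by convention. Vanishing sums: a vanishing sum $\sum_{j} a_j\zeta_j=0$ with $a_j$ non-zero and $\zeta_j$ roots of unity is irreducible if no proper non-empty subsum (sum over a proper non-empty subset of the indices) vanishes. ''Roots of unity of order $h$'' means $h$-th roots of unity. The irreducible vanishing sums induced by $P$ are the irreducible subsums of the displayed sum over $J$: a non-empty vanishing subsum over $J'\subseteq J$ with no proper non-empty vanishing subsum, divided by the common factor $\prod_{i\in J\setminus J'}d_i$. Associated polygon: a vanishing sum $\sum_{j=1}^k a_j\zeta_j=0$ with positive integer coefficients $a_j$ is interpreted as a convex $k$-sided polygon whose sides, taken as vectors in $\mathbb C$ ordered by argument, are $a_1\zeta_1,\dots,a_k\zeta_k$, so the side lengths are the $a_j$. Such a polygon may be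 degenerate (e.g. two of the $\zeta_j$ may be equal, or $k=2$). *)

(* Defs.v *)
From mathcomp Require Import all_boot all_order all_algebra.
From mathcomp Require Import finmap.
From mathcomp Require Import boolp classical_sets cardinality.
From mathcomp Require Import reals trigo.
From mathcomp Require Import complex.

Set Implicit Arguments.
Unset Strict Implicit.
Unset Printing Implicit Defensive.

Import Order.TTheory GRing.Theory Num.Theory.

Local Open Scope classical_set_scope.
Local Open Scope ring_scope.
Local Open Scope complex_scope.

Section Groups.
Local Open Scope group_scope.
Implicit Types F : groupType.

(* Universal property; between groups a multiplicative map is a homomorphism. *)
Definition freely_generated F (I : Type) (x : I -> F) : Prop :=
  forall (G : groupType) (y : I -> G),
    exists f : {multiplicative F -> G},
      (forall a, f (x a) = y a) /\
      (forall g : {multiplicative F -> G}, (forall a, g (x a) = y a) -> g =1 f).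

Definition subgroup F (H : set F) : Prop := group_closed (mem H).

Definition rtranslate F (u : set F) (g : F) : set F := [set y * g | y in u].

Definition right_cosets F (H : set F) : set (set F) :=
  [set rtranslate H g | g in [set: F]].

Definition finite_index F (H : set F) : Prop := finite_set (right_cosets H).

(* This is 0 when H has infinite index. *)
Definition subgroup_index F (H : set F) : nat := #|` fset_set (right_cosets H)|%fset.

Definition coset_partition F (s : nat) (H : 'I_s -> set F) (alpha : 'I_s -> F)
    : Prop :=
  [/\ forall i, subgroup (H i),
      forall i, finite_index (H i),
      trivIset [set: 'I_s] (fun i => rtranslate (H i) (alpha i)) &
      \bigcup_i rtranslate (H i) (alpha i) = [set: F]].

Definition edge F n (x : 'I_n -> F) (a : 'I_n) : rel (set F) :=
  fun u v => v == rtranslate u (x a).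

(* The vertices of the Schreier graph of H are numbered by enum_val. *)
Definition transition_matrix F n (x : 'I_n -> F) (H : set F) :
    'M[nat]_#|{: fset_set (right_cosets H)}| :=
  \matrix_(i, j) #|[pred a | edge x a (val (enum_val i)) (val (enum_val j))]|.

(* Paths are lists of successive vertices, so the empty list is the path of
   length 0 from u to itself. *)
Definition is_min_path_length F n (x : 'I_n -> F) (u v : set F) (m : nat)
    : Prop :=
  let is_path p := path (fun w w' => [exists a, edge x a w w']) u p
                   /\ last u p = v in
  (exists2 p, is_path p & size p = m) /\ (forall p, is_path p -> (m <= size p)%N).

End Groups.

Definition is_gcd (S : set nat) (g : nat) : Prop :=
  (forall m, S m -> (g %| m)%N) /\
  (forall e, (forall m, S m -> (e %| m)%N) -> (e %| g)%N).

(* For irreducible A the gcd is the same at every index i. *)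
Definition is_period d (A : 'M[nat]_d) (h : nat) : Prop :=
  forall i, is_gcd [set m | (0 < m)%N /\ (0 < (A ^+ m) i i)%N] h.

Section VanishingSums.
Variable R : realType.

Definition cis (t : R) : R[i] := cos t +i* sin t.

Section Sums.
Variables (I : finType) (h : nat) (a : I -> nat) (z : I -> R[i]).

Definition vanishing_sum (K : {set I}) : Prop :=
  [/\ forall j, j \in K -> (0 < a j)%N,
      forall j, j \in K -> h.-unity_root (z j) &
      \sum_(j in K) (a j)%:R * z j = 0].

Definition irreducible_vanishing_sum (K : {set I}) : Prop :=
  [/\ K != finset.set0,
      vanishing_sum K &
      forall L : {set I}, L \proper K -> L != finset.set0 ->
        \sum_(j in L) (a j)%:R * z j <> 0].

End Sums.

Definition cross (u v : R[i]) : R :=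
  complex.Re u * complex.Im v - complex.Im u * complex.Re v.

(* A polygon is the cyclic sequence of its vertices; ordS is the cyclic
   successor. *)
Definition side k (p : 'I_k -> R[i]) (i : 'I_k) : R[i] := p (ordS i) - p i.

(* Counterclockwise convexity: each side has all the vertices weakly on its
   left.  Degenerate polygons are allowed. *)
Definition convex_polygon k (p : 'I_k -> R[i]) : Prop :=
  forall i l, 0 <= cross (side p i) (p l - p i).

(* The numbering e of K lists the terms a j * z j by increasing argument
   theta in [0, 2 pi), so that the sides of p turn only once around. *)
Definition associated_polygon (I : finType) (K : {set I}) (a : I -> nat)
    (z : I -> R[i]) (p : 'I_#|K| -> R[i]) : Prop :=
  exists (e : 'I_#|K| -> I) (theta : 'I_#|K| -> R),
    [/\ injective e /\ (forall j, (j \in K) = [exists i, e i == j]),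
        (forall i, 0 <= theta i < 2 * pi /\ z (e i) = cis (theta i)) /\
        (forall i l : 'I_#|K|, (i <= l)%N -> theta i <= theta l),
        forall i, side p i = (a (e i))%:R * z (e i) /\
                  `|side p i| = (a (e i))%:R &
        convex_polygon p].

End VanishingSums.

(* Main.v *)
(** Let [F] act by translation on all right cosets of the [H i], and let every
    free generator be sent to [1] in the integers modulo [h].  Together these
    give a map from [F] onto a finite group [Q], and [omega] a character [chi]
    of [Q] with zero sum.  As [Q] is finite, its elements are images of positive
    words, so the period [h_ i] decides whether [chi] is trivial on the image of
    [H i]: this happens exactly when [h] divides [h_ i], that is when
    [h_ i = h].  Summing [chi] over the cosets of the partition, the parts with
    [h_ i <> h] contribute [0] and the others [#|Q| / d i * omega ^+ m i].  No
    asymptotics of powers of the transition matrices is needed. *)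
From HB Require Import structures.
Require Import Defs.
From mathcomp Require Import all_boot all_order all_fingroup all_algebra finmap.
From mathcomp Require Import boolp classical_sets cardinality.
From mathcomp Require Import reals trigo complex.
From mathcomp Require Import ring lra.

Set Implicit Arguments.
Unset Strict Implicit.
Unset Printing Implicit Defensive.

Import Order.TTheory GRing.Theory Num.Theory.

(** * Positive entries of powers of matrices of natural numbers *)

Lemma exprS_natmx_gt0 d (A : 'M[nat]_d) m i j :
  (0 < (A ^+ m.+1)%R i j)%N =
    [exists k, (0 < A i k)%N && (0 < (A ^+ m)%R k j)%N].
Proof.
rewrite GRing.exprS mxE.
(* The ring sum and the sum of natural numbers are convertible; the latter has no cancellation, so
   it is nonzero exactly when some term is. *)
have -> : (\sum_k A i k * (A ^+ m) k j)%R =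
          (\sum_k (A i k * (A ^+ m)%R k j))%N by [].
rewrite lt0n sum_nat_eq0 negb_forall; apply: eq_existsb => k.
by rewrite /= muln_eq0 negb_or !lt0n.
Qed.

(** * Positive words, paths in Schreier graphs and finite quotients *)

Section Words.
Local Open Scope group_scope.
Variables (F : groupType) (n : nat) (x : 'I_n -> F).

Definition word_prod (w : seq 'I_n) : F := \prod_(a <- w) x a.

Lemma word_prod_nil : word_prod [::] = 1.
Proof. exact: big_nil. Qed.

Lemma word_prod_cons a w : word_prod (a :: w) = x a * word_prod w.
Proof. exact: big_cons. Qed.

Lemma rtranslate1 (u : set F) : rtranslate u 1 = u.
Proof.
apply/seteqP; split=> g /=; first by case=> y uy <-; rewrite mulg1.
by move=> ug; exists g; rewrite ?mulg1.
Qed.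

Lemma rtranslateM (u : set F) g h :
  rtranslate (rtranslate u g) h = rtranslate u (g * h).
Proof.
apply/seteqP; split=> k /=.
  by case=> _ [y uy <-] <-; exists y; rewrite ?mulgA.
by case=> y uy <-; exists (y * g); [exists y|rewrite mulgA].
Qed.

Lemma right_cosets_rtranslate (H u : set F) g :
  right_cosets H u -> right_cosets H (rtranslate u g).
Proof. by case=> k _ <-; exists (k * g); rewrite ?rtranslateM. Qed.

Lemma right_cosets_self (H : set F) : right_cosets H H.
Proof. by exists 1; rewrite ?rtranslate1. Qed.

Lemma path_word (u v : set F) p :
  path (fun w w' => [exists a, edge x a w w']) u p -> last u p = v ->
  exists2 w, size w = size p & rtranslate u (word_prod w) = v.
Proof.
elim: p u => [|u' p IHp] u /=.
  by move=> _ <-; exists [::]; rewrite // word_prod_nil rtranslate1.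
case/andP=> /existsP[a /eqP->] /IHp {}IHp /IHp[w sw <-].
by exists (a :: w); rewrite /= ?sw // word_prod_cons rtranslateM.
Qed.

(** This turns the period, defined by matrix powers, into a statement about word lengths: an edge is
    right translation by a generator, so following a path means multiplying by a positive word. *)
Lemma transition_matrix_gt0P (H : set F) m i j : finite_index H ->
  reflect (exists2 w, size w = m &
             rtranslate (val (enum_val i)) (word_prod w) = val (enum_val j))
    (0 < (transition_matrix x H ^+ m)%R i j)%N.
Proof.
move=> finH; apply: (iffP idP).
  elim: m i => [|m IHm] i.
    rewrite GRing.expr0 mxE; case: eqP => // <- _.
    by exists [::]; rewrite // word_prod_nil rtranslate1.
  rewrite exprS_natmx_gt0 => /existsP[k /andP[]].
  rewrite mxE => /card_gt0P[a].
  rewrite inE => ea /IHm[w sw ew]; exists (a :: w); first by rewrite /= sw.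
  by rewrite -ew ea rtranslateM word_prod_cons.
case=> w; elim: w m i => [|a w IHw] m i /= <- {m}.
  rewrite word_prod_nil rtranslate1 => /val_inj/enum_val_inj ->.
  by rewrite GRing.expr0 mxE eqxx.
rewrite word_prod_cons -rtranslateM => ew.
have uH : rtranslate (val (enum_val i)) (x a) \in fset_set (right_cosets H).
  rewrite in_fset_set // inE; apply: right_cosets_rtranslate.
  by have := fsvalP (enum_val i); rewrite in_fset_set // inE.
pose k := enum_rank ([` uH]%fset : fset_set (right_cosets H)).
have ek : val (enum_val k) = rtranslate (val (enum_val i)) (x a).
  by rewrite enum_rankK.
rewrite exprS_natmx_gt0; apply/existsP; exists k; rewrite mxE.
apply/andP; split.
  by apply/card_gt0P; exists a; rewrite inE /edge ek.
by apply: IHw => //; rewrite ek.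
Qed.

(* Uniqueness in the universal property, tested on the subgroup generated by
   the images of the free generators, shows that this subgroup is everything;
   in a finite group no inverses of generators are needed. *)
Lemma freely_generated_word (gT : finGroupType) (f : {multiplicative F -> gT})
    (g : F) :
  freely_generated x -> exists w, f g = f (word_prod w).
Proof.
move=> freex; pose S := <<[set f (x a) | a : 'I_n]>>%G.
have Sf a : f (x a) \in S by rewrite mem_gen ?imset_f.
have [f' [f'x _]] := freex _ (fun a => subg S (f (x a))).
pose h : F -> gT := @sgval _ S \o f'.
have hM : {morph h : y z / y * z} by move=> y z; rewrite /h /= gmulfM.
pose hmM := isMultiplicative.Build _ _ h hM.
pose f2 : {multiplicative F -> gT} := HB.pack h hmM.
have [f0 [_ uniq0]] := freex _ (fun a => f (x a)).
have eqf : f =1 f2.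
  move=> y; rewrite (uniq0 f) // -(uniq0 f2) // => a.
  by rewrite /= /h /= f'x subgK.
have : f g \in S by rewrite eqf; exact: subgP.
case/gen_prodgP=> k [c Sc ->].
have /fin_all_exists [a ac] i : exists a, c i = f (x a).
  by have /imsetP[a _ ->] := Sc i; exists a.
exists [seq a i | i <- index_enum 'I_k].
have f1 : f 1 = 1 by apply: (mulgI (f 1)); rewrite -gmulfM !mulg1.
rewrite /word_prod (big_morph f (@gmulfM _ _ f) f1) big_map.
exact: eq_bigr.
Qed.

End Words.

(** * Sums of a character over the fibers of a finite group action *)

Section FiberSums.
Local Open Scope ring_scope.
Variables (gT : finGroupType) (X : finType) (rho : gT -> {perm X}).
Variables (L : idomainType) (chi : gT -> L) (Q : {group gT}) (v : X).
Hypothesis rhoM : {morph rho : p q / (p * q)%g}.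
Hypothesis chiM : forall p q, chi (p * q)%g = chi p * chi q.

(** Right multiplication by [q0] carries the stabilizer of [v] onto the fiber over [rho q0 v] and
    multiplies [chi] by [chi q0]. *)
Lemma fiber_sum q0 : q0 \in Q ->
  \sum_(q in Q | rho q v == rho q0 v) chi q =
    (\sum_(q in Q | rho q v == v) chi q) * chi q0.
Proof.
move=> Qq0; rewrite mulr_suml (reindex_inj (mulIg q0)) /=.
apply: eq_big => [q|q _]; last by rewrite chiM.
by rewrite groupMr // rhoM permM (inj_eq perm_inj).
Qed.

(** For [q0] in the stabilizer the fiber is the stabilizer itself, so its sum is unchanged by the
    factor [chi q0]; in an integral domain it must vanish. *)
Lemma stabilizer_sum_eq0 q0 : q0 \in Q -> rho q0 v = v -> chi q0 != 1 ->
  \sum_(q in Q | rho q v == v) chi q = 0.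
Proof.
move=> Qq0 vq0; have := fiber_sum Qq0; rewrite vq0 => /eqP.
rewrite -{1}[X in X == _]mulr1 -subr_eq0 -mulrBr mulf_eq0 subr_eq0.
by case/orP => [/eqP->|/eqP->]; rewrite ?eqxx.
Qed.

Lemma fiber_card q0 : q0 \in Q ->
  #|[pred q in Q | rho q v == rho q0 v]| = #|[pred q in Q | rho q v == v]|.
Proof.
move=> Qq0; rewrite -!sum1_card (reindex_inj (mulIg q0)) /=.
apply: eq_bigl => q; rewrite !inE.
by rewrite groupMr // rhoM permM (inj_eq perm_inj).
Qed.

Lemma orbit_stabilizer_card (O : {set X}) :
    (forall w, reflect (exists2 q, q \in Q & rho q v = w) (w \in O)) ->
  #|Q| = (#|O| * #|[pred q in Q | rho q v == v]|)%N.
Proof.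
move=> OP; rewrite -sum1_card.
rewrite (partition_big (fun q => rho q v) [in O]) /=; last first.
  by move=> q Qq; apply/OP; exists q.
rewrite -sum_nat_const; apply: eq_bigr => w /OP[q Qq <-].
by rewrite -(fiber_card Qq) -sum1_card; apply: eq_bigl => q'; rewrite !inE.
Qed.

End FiberSums.

Lemma rtranslate_eqP (F : groupType) (H : set F) (g k : F) : subgroup H ->
  rtranslate H k g <-> rtranslate H g = rtranslate H k.
Proof.
case=> H1 HF; have Hd y z : H y -> H z -> H (y * z^-1)%g.
  by move=> Hy Hz; apply/set_mem/HF; exact/mem_set.
have {}H1 : H 1%g by exact/set_mem.
split=> [[y Hy <-]|<-]; last by exists 1%g; rewrite ?mul1g.
apply/seteqP; split=> _ [z Hz <-] /=.
  exists (z * y)%g; last by rewrite mulgA.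
  by rewrite -[y]invgK -[y^-1%g]mul1g; apply/Hd/Hd.
by exists (z * y^-1)%g; [exact: Hd|rewrite mulgA mulgVK].
Qed.

(** * The character sum of a coset partition *)

Section CosetPartition.
Local Open Scope ring_scope.
Local Open Scope classical_set_scope.
Variables (F : groupType) (n : nat) (x : 'I_n -> F) (s : nat).
Variables (H : 'I_s -> set F) (alpha : 'I_s -> F) (h_ m : 'I_s -> nat).
Variables (L : idomainType) (h : nat) (omega : L).
Hypothesis freex : freely_generated x.
Hypothesis partH : coset_partition H alpha.
Hypothesis perH : forall i, is_period (transition_matrix x (H i)) (h_ i).
Hypothesis h_gt1 : (1 < h)%N.
Hypothesis h_max : forall i, (h_ i <= h)%N.
Hypothesis omega_prim : h.-primitive_root omega.
Hypothesis n_gt0 : (0 < n)%N.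
Hypothesis wordm : forall i, h_ i = h -> exists2 w, size w = m i &
  rtranslate (H i) (word_prod x w) = rtranslate (H i) (alpha i).

(** Gathering the vertices of all the Schreier graphs lets a single finite group serve every
    subgroup at once. *)
Let all_cosets : set (set F) := \bigcup_i right_cosets (H i).

Let finH i : finite_index (H i). Proof. by case: partH. Qed.

Let finite_all_cosets : finite_set all_cosets.
Proof.
by apply: bigcup_finite => [|i _]; [exact: finite_finset|exact: finH].
Qed.

Let X : finType := fset_set all_cosets.

Let X_val (v : X) : all_cosets (val v).
Proof. by have := fsvalP v; rewrite in_fset_set // inE. Qed.

Let mkX u (uC : all_cosets u) : {v : X | val v = u}.
Proof.
have uX : u \in fset_set all_cosets by rewrite in_fset_set // inE.
by exists [` uX]%fset.
Qed.

Let all_cosets_rtranslate (v : X) g : all_cosets (rtranslate (val v) g).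
Proof.
by have [i _ vi] := X_val v; exists i => //; apply: right_cosets_rtranslate.
Qed.

Let trans g (v : X) : X := sval (mkX (all_cosets_rtranslate v g)).

Let val_trans g v : val (trans g v) = rtranslate (val v) g.
Proof. exact: svalP (mkX _). Qed.

Let trans_inj g : injective (trans g).
Proof.
move=> u v /(congr1 val); rewrite !val_trans.
move=> /(congr1 (fun w : set F => rtranslate w g^-1%g)).
by rewrite !rtranslateM mulgV !rtranslate1 => /val_inj.
Qed.

(** The second factor is the additive group of integers modulo [h], as [(Zp_trunc h).+2] is [h] for
    [h > 1]; it will record word lengths modulo [h]. *)
Let gT : finGroupType := ({perm X} * 'I_(Zp_trunc h).+2)%type.

Let chi (q : gT) : L := omega ^+ q.2.

Let chiM p q : chi (p * q)%g = chi p * chi q.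
Proof.
have primZ : (Zp_trunc h).+2.-primitive_root omega by rewrite Zp_cast.
by rewrite /chi /= -exprD -[RHS](prim_expr_mod primZ).
Qed.

(** A division-free form of the vanishing of the sum of the [omega ^+ m j / d j]: [q] is the order
    of the finite image of [F] and [k i] counts its elements that fix the vertex [H i], so [k i]
    stands for [q] divided by the index. *)
Lemma partition_character_sum :
  exists (q : nat) (k : 'I_s -> nat),
    [/\ (0 < q)%N, forall i, q = (subgroup_index (H i) * k i)%N &
        \sum_(j | h_ j == h) (k j)%:R * omega ^+ m j = 0].
Proof.
have [subH _ tivH coverH] := partH.
have [phi [phix _]] := freex (fun=> 1%R : 'I_(Zp_trunc h).+2).
have [f [fE fx]] : exists f : {multiplicative F -> gT},
    (forall g v, val ((f g).1 v) = rtranslate (val v) g) /\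
    (forall a, (f (x a)).2 = 1%R).
  pose f (g : F) : gT := (perm (@trans_inj g), phi g).
  have fM : {morph f : p q / (p * q)%g}.
    move=> p q; congr pair; last exact: gmulfM.
    apply/permP => v; rewrite permM !permE; apply: val_inj.
    by rewrite !val_trans rtranslateM.
  pose fmM := isMultiplicative.Build _ _ f fM.
  exists (HB.pack f fmM : {multiplicative F -> gT}).
  by split=> [g v|a] /=; rewrite ?permE ?val_trans ?phix.
have f1 : f 1%g = 1%g by apply: (mulgI (f 1%g)); rewrite -gmulfM !mulg1.
have chi_word w : chi (f (word_prod x w)) = omega ^+ size w.
  elim: w => [|a w IHw]; first by rewrite word_prod_nil f1.
  rewrite word_prod_cons gmulfM chiM IHw exprS; congr (_ * _).
  by rewrite /chi fx /= modn_small.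
have fword g : exists w, f g = f (word_prod x w).
  exact: freely_generated_word.
(* The image of [F] is taken instead of all of [gT], so that the orbit of [H i] consists exactly of
   its right cosets. *)
pose Qs := [set q : gT | `[< exists g, f g = q >]]%SET.
have QsP q : reflect (exists g, f g = q) (q \in Qs).
  by rewrite inE; exact: asboolP.
have gQ : group_set Qs.
  apply/group_setP; split; first by apply/QsP; exists 1%g.
  move=> _ _ /QsP[p <-] /QsP[q <-].
  by apply/QsP; exists (p * q)%g; rewrite gmulfM.
pose Q := Group gQ.
have Qf g : f g \in Q by apply/QsP; exists g.
pose rho (q : gT) := q.1.
have rhoM : {morph rho : p q / (p * q)%g} by [].
have HC i : all_cosets (H i) by exists i => //; exact: right_cosets_self.
pose v i : X := sval (mkX (HC i)).
have vE i : val (v i) = H i by exact: svalP (mkX _).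
have fP i g k : rtranslate (H i) g = rtranslate (H i) k <->
    rho (f g) (v i) = rho (f k) (v i).
  by split=> [e|/(congr1 val)]; [apply: val_inj|]; rewrite !fE vE.
have fvP i g : rtranslate (H i) g = H i <-> rho (f g) (v i) = v i.
  by rewrite -[in X in _ = X](rtranslate1 (H i)) fP f1 /= perm1.
exists #|Q|, (fun i => #|[pred q in Q | rho q (v i) == v i]|).
split=> [|i|]; first exact: cardG_gt0.
  pose O := [set w : X | `[< right_cosets (H i) (val w) >]]%SET.
  (* [RO] embeds the cosets of [H i] into [X], where the index becomes the size of an orbit. *)
  have RO (u : fset_set (right_cosets (H i))) : {w : X | val w = val u}.
    apply: mkX; exists i => //=; have := fsvalP u.
    by rewrite in_fset_set ?inE; [|exact: finH].
  have -> : subgroup_index (H i) = #|O|.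
    rewrite /subgroup_index cardfE -cardsT.
    rewrite -(card_imset _ (f := fun u => sval (RO u))).
      apply: eq_card => w; rewrite inE; apply/imsetP/asboolP.
        case=> u _ ->; rewrite (svalP (RO u)); have := fsvalP u.
        by rewrite in_fset_set ?inE; [|exact: finH].
      move=> Hw; have uP : val w \in fset_set (right_cosets (H i)).
        by rewrite in_fset_set ?inE; [|exact: finH].
      by exists [` uP]%fset => //; apply: val_inj; rewrite (svalP (RO _)).
    by move=> u u' /(congr1 val); rewrite !(svalP (RO _)) => /val_inj.
  apply: (orbit_stabilizer_card (v := v i) rhoM) => w; rewrite inE.
  apply: (iffP (asboolP _)) => [[g _ gw]|[_ /QsP[g <-] <-]].
    by exists (f g) => //; apply: val_inj; rewrite fE vE.
  by exists g => //; rewrite fE vE.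
have chi1 : chi (f (word_prod x [:: Ordinal n_gt0])) != 1.
  rewrite chi_word expr1 -(expr1 omega) -(prim_order_dvd omega_prim).
  by rewrite dvdn1 neq_ltn h_gt1 orbT.
have sumQ : \sum_(q in Q) chi q = 0.
  (* The index [i] only supplies a point of [X]: under the trivial action the stabilizer of any
     point is all of [Q], so [stabilizer_sum_eq0] applies to the full sum. *)
  have [i _ _] : (\bigcup_i rtranslate (H i) (alpha i)) 1%g by rewrite coverH.
  have triv1 : {morph (fun=> 1%g : {perm X}) :
      p q / (p * q : gT)%g >-> (p * q)%g}.
    by move=> ? ?; rewrite mulg1.
  have := stabilizer_sum_eq0 (v := v i) triv1 chiM (Qf _) (perm1 _) chi1.
  by under eq_bigl => q do rewrite perm1 eqxx andbT.
(* The period is read at the vertex [H i] itself, where closed paths are words fixing this coset. *)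
have loopP i : is_gcd [set k | (0 < k)%N /\
    exists2 w, size w = k & rtranslate (H i) (word_prod x w) = H i] (h_ i).
  have uP : H i \in fset_set (right_cosets (H i)).
    by rewrite in_fset_set ?inE; [exact: right_cosets_self|exact: finH].
  have uE : val (enum_val (enum_rank [` uP]%fset)) = H i by rewrite enum_rankK.
  congr is_gcd: (@perH i (enum_rank [` uP]%fset)).
  apply/seteqP; split=> k [k0 ww]; split=> //.
    have /(transition_matrix_gt0P _ _ _ _ (finH i))[w sw] := ww.
    by rewrite uE; exists w.
  by apply/(transition_matrix_gt0P _ _ _ _ (finH i)); rewrite uE.
(* Repeating a generator as often as the order of its image gives a loop of positive length, which
   excludes period [0]. *)
have loop_gt0 i : (0 < h_ i)%N.
  pose o := #[f (x (Ordinal n_gt0))]%g.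
  apply: (dvdn_gt0 (order_gt0 _ : 0 < o)%N); apply: (loopP i).1.
  split; first exact: order_gt0.
  exists (nseq o (Ordinal n_gt0)); first by rewrite size_nseq.
  apply/fvP; have -> : f (word_prod x (nseq o (Ordinal n_gt0))) = 1%g.
    rewrite -[RHS](expg_order (f (x (Ordinal n_gt0)))) -/o.
    elim: (o) => [|k IHk]; first by rewrite word_prod_nil.
    by rewrite word_prod_cons gmulfM IHk expgS.
  by rewrite /rho perm1.
(* If [h] divided all loop lengths, it would divide [h_ i], and maximality of [h] would force
   equality. *)
have loop_nontriv i : h_ i != h ->
    exists2 w, rtranslate (H i) (word_prod x w) = H i & ~~ (h %| size w)%N.
  apply: contraNP => noloop; rewrite eqn_leq h_max dvdn_leq //.
  apply: (loopP i).2 => k [_ [w <- wi]].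
  by apply: contrapT => /negP hw; apply: noloop; exists w.
have stabJ i q : h_ i = h -> q \in Q -> rho q (v i) = v i -> chi q = 1.
  move=> hi /QsP[g <-]; have [w ->] := fword g => /fvP wi.
  apply/eqP; rewrite chi_word -(prim_order_dvd omega_prim).
  (* The empty word is treated apart, since the period only sees loops of positive length. *)
  have [->|w_gt0] := posnP (size w); first exact: dvdn0.
  by rewrite -hi; apply: (loopP i).1; split=> //; exists w.
rewrite -[RHS]sumQ.
(* Each element of [F] lies in exactly one part, so after exchanging the sums exactly one index
   contributes for each element of [Q]. *)
have -> : \sum_(q in Q) chi q =
    \sum_i \sum_(q in Q | rho q (v i) == rho (f (alpha i)) (v i)) chi q.
  rewrite (eq_bigr (fun i => \sum_(q in Q)
      if rho q (v i) == rho (f (alpha i)) (v i) then chi q else 0)); last first.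
    by move=> i _; rewrite big_mkcondr.
  rewrite exchange_big /=; apply: eq_bigr => _ /QsP[g <-].
  have [i _ gi] : (\bigcup_i rtranslate (H i) (alpha i)) g by rewrite coverH.
  rewrite -big_mkcond (big_pred1 i) // => j /=; apply/eqP/eqP => [|->].
    move/fP/(rtranslate_eqP _ _ (subH j)) => gj.
    by apply: tivH => //; exists g.
  by apply/fP/(rtranslate_eqP _ _ (subH i)).
rewrite [RHS](bigID (fun i => h_ i == h)) /= [X in _ = _ + X]big1 ?addr0.
  apply: eq_bigr => i /eqP hi; have [w sw wi] := wordm hi.
  (* The representative [alpha i] is replaced by a word of length [m i] leading to the same coset,
     whose character value is [omega ^+ m i]. *)
  rewrite -((fP _ _ _).1 wi).
  rewrite (fiber_sum (v i) rhoM chiM (Qf (word_prod x w))) chi_word sw.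
  congr (_ * _); rewrite -sum1_card natr_sum /=.
  apply: eq_big => [q|q]; first by rewrite inE.
  by case/andP=> Qq /eqP qv; rewrite (stabJ i q).
move=> i /loop_nontriv[w /fvP wi hw].
rewrite (fiber_sum (v i) rhoM chiM (Qf (alpha i))).
rewrite (stabilizer_sum_eq0 rhoM chiM (Qf _) wi).
  by rewrite mul0r.
by rewrite chi_word -(prim_order_dvd omega_prim).
Qed.
End CosetPartition.

(** * Complex roots of unity in trigonometric form *)

Section RootsOfUnity.
Local Open Scope ring_scope.
Local Open Scope complex_scope.
Variable R : realType.

Lemma cis0 : cis (0 : R) = 1.
Proof. by rewrite /cis cos0 sin0. Qed.

Lemma cisD (s t : R) : cis (s + t) = cis s * cis t.
Proof. by rewrite /cis cosD sinD; simpc; congr (_ +i* _); ring. Qed.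

Lemma cisX (t : R) k : cis t ^+ k = cis (t * k%:R).
Proof.
elim: k => [|k IHk]; first by rewrite mulr0 cis0.
by rewrite exprS IHk -natr1 mulrDr mulr1 addrC cisD.
Qed.

(** If [cos t = 1], the double-angle formula gives [sin (t / 2) ^+ 2 = 0], whereas the sine is
    positive strictly between [0] and [pi]. *)
Lemma cis_neq1 (t : R) : 0 < t < 2 * pi -> cis t != 1.
Proof.
move=> t02pi; apply/eqP => -[cost _].
have s_gt0 : 0 < sin (t / 2) by apply: sin_gt0_pi; lra.
have : sin (t / 2) ^+ 2 = 0.
  have := cos_mulr2n (t / 2); rewrite cos2sin2.
  by rewrite -[t / 2 *+ 2]mulr_natr mulfVK ?pnatr_eq0 // cost => ?; lra.
by move/eqP; rewrite expf_eq0 /= gt_eqF.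
Qed.

Lemma cis_primitive_root h : (0 < h)%N ->
  h.-primitive_root (cis (2 * pi / h%:R) : R[i]).
Proof.
move=> h_gt0; rewrite /primitive_root_of_unity h_gt0 /=.
have hR : 0 < h%:R :> R by rewrite ltr0n.
apply/forallP => i; rewrite unity_rootE cisX.
have [->|ih] := eqVneq i.+1 h.
  rewrite mulfVK ?(gt_eqF hR) // [2 * _]mulrC mulr_natr /cis cos2pi sin2pi.
  apply/eqP; exact: eqxx.
apply/eqP/negbTE/cis_neq1; have pi0 := pi_gt0 R.
rewrite mulr_gt0 ?divr_gt0 ?mulr_gt0 ?ltr0n //=.
rewrite mulrAC ltr_pdivrMr // ltr_pM2l ?mulr_gt0 // ltr_nat.
by rewrite ltn_neqAle ih ltn_ord.
Qed.

End RootsOfUnity.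

(** * Convexity of the polygon of a vanishing sum *)

Section Polygon.
Local Open Scope ring_scope.
Local Open Scope complex_scope.
Variable R : realType.
Implicit Types u v : R[i].

Lemma crossDr u v w : cross u (v + w) = cross u v + cross u w.
Proof. by case: u v w => [? ?] [? ?] [? ?]; rewrite /cross /=; ring. Qed.

Lemma cross0r u : cross u 0 = 0.
Proof. by rewrite /cross /= !mulr0 subrr. Qed.

Lemma crossBr u v w : cross u (v - w) = cross u v - cross u w.
Proof. by case: u v w => [? ?] [? ?] [? ?]; rewrite /cross /=; ring. Qed.

Lemma cross_sumr u I (r : seq I) (P : pred I) (E : I -> R[i]) :
  cross u (\sum_(i <- r | P i) E i) = \sum_(i <- r | P i) cross u (E i).
Proof. exact: (big_morph (cross u) (crossDr u) (cross0r u)). Qed.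

Lemma cross_cis (a b : nat) (s t : R) :
  cross (a%:R * cis s) (b%:R * cis t) = a%:R * b%:R * sin (t - s).
Proof.
have cnat k : k%:R = (k%:R)%:C :> R[i] by rewrite rmorph_nat.
by rewrite /cross !cnat /= sinB; ring.
Qed.

Lemma norm_cis (a : nat) (t : R) : `|a%:R * cis t| = a%:R.
Proof.
by rewrite normrM normr_nat normc_def /= cos2Dsin2 sqrtr1 mulr1.
Qed.

(* The cross product of side [i] with the chord from vertex [i] to vertex [l]
   is a partial sum of [sin (theta k - theta i)]; as the complete sum vanishes,
   it may be replaced by minus the complementary sum, and one of the two has
   all its terms of the right sign. *)
Lemma partial_sum_sin_ge0 N (theta : 'I_N -> R) (a : 'I_N -> nat)
    (c := fun i k => (a i)%:R * (a k)%:R * sin (theta k - theta i))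
    (i l : 'I_N) :
    (forall k, 0 <= theta k < 2 * pi) ->
    (forall k k' : 'I_N, (k <= k')%N -> theta k <= theta k') ->
    \sum_k c i k = 0 ->
  0 <= \sum_(k < N | (k < l)%N) c i k - \sum_(k < N | (k < i)%N) c i k.
Proof.
move=> th02pi th_le sum0.
(* Subtracting [lam] times the vanishing total costs nothing: [lam = 0] keeps the range between [i]
   and [l], while [1] for [i <= l] and [- 1] for [l < i] pass to its complement. *)
have coefE (lam : R) :
    \sum_(k < N | (k < l)%N) c i k - \sum_(k < N | (k < i)%N) c i k =
    \sum_(k < N) ((k < l)%N%:R - (k < i)%N%:R - lam) * c i k.
  under [RHS]eq_bigr do rewrite !mulrBl.
  rewrite !sumrB -mulr_sumr sum0 mulr0 subr0.
  rewrite [X in X - _]big_mkcond [X in _ - X]big_mkcond /=.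
  by congr (_ - _); apply: eq_bigr => k _; case: ifP; rewrite ?mul1r ?mul0r.
have aa_ge0 k : 0 <= (a i)%:R * (a k)%:R :> R by rewrite mulr_ge0.
have c_ge0 k : 0 <= theta k - theta i <= pi -> 0 <= c i k.
  by move=> ?; rewrite mulr_ge0 // sin_ge0_pi.
have c_le0 k : 0 <= theta i - theta k <= pi -> c i k <= 0.
  by move=> ?; rewrite mulr_ge0_le0 // -opprB sinN oppr_le0 sin_ge0_pi.
have sin2pi t : sin (t + 2 * pi) = sin t :> R.
  by rewrite mulrC mulr_natr sinD2pi.
have c_ge0' k : pi <= theta i - theta k -> 0 <= c i k.
  move=> ?; have /andP[? ?] := th02pi k; have /andP[? ?] := th02pi i.
  by rewrite mulr_ge0 // -sin2pi sin_ge0_pi //; lra.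
have c_le0' k : pi <= theta k - theta i -> c i k <= 0.
  move=> ?; have /andP[? ?] := th02pi k; have /andP[? ?] := th02pi i.
  by rewrite mulr_ge0_le0 // -opprB sinN oppr_le0 -sin2pi sin_ge0_pi //; lra.
have /andP[i0 i2] := th02pi i; have /andP[l0 l2] := th02pi l.
have [il|/ltnW li] := leqP i l.
  (* If the angle from side [i] to side [l] is at most [pi], all sines in between are nonnegative;
     otherwise those outside the range are nonpositive. *)
  have [near|far] := lerP (theta l - theta i) pi.
    rewrite (coefE 0); apply: sumr_ge0 => k _; rewrite subr0.
    have [kl|lk] := ltnP k l; have [ki|ik] := ltnP k i.
    - by rewrite subrr mul0r.
    - have := th_le _ _ ik; have := th_le _ _ (ltnW kl) => ? ?.
      by rewrite subr0 mul1r c_ge0 //; lra.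
    - by have := leq_ltn_trans (leq_trans il lk) ki; rewrite ltnn.
    - by rewrite subrr mul0r.
  rewrite (coefE 1); apply: sumr_ge0 => k _.
  have [kl|lk] := ltnP k l; have [ki|ik] := ltnP k i.
  - have := th_le _ _ (ltnW ki); have /andP[? ?] := th02pi k => ?.
    by rewrite subrr sub0r mulN1r oppr_ge0 c_le0 //; lra.
  - by rewrite subr0 subrr mul0r.
  - by have := leq_ltn_trans (leq_trans il lk) ki; rewrite ltnn.
  - have := th_le _ _ lk => ?.
    by rewrite subrr sub0r mulN1r oppr_ge0 c_le0' //; lra.
have [near|far] := lerP (theta i - theta l) pi.
  rewrite (coefE 0); apply: sumr_ge0 => k _; rewrite subr0.
  have [kl|lk] := ltnP k l; have [ki|ik] := ltnP k i.
  - by rewrite subrr mul0r.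
  - by have := leq_ltn_trans (leq_trans li ik) kl; rewrite ltnn.
  - have := th_le _ _ (ltnW ki); have := th_le _ _ lk => ? ?.
    by rewrite sub0r mulN1r oppr_ge0 c_le0 //; lra.
  - by rewrite subrr mul0r.
rewrite (coefE (- 1)); apply: sumr_ge0 => k _; rewrite opprK.
have [kl|lk] := ltnP k l; have [ki|ik] := ltnP k i.
- have := th_le _ _ (ltnW kl) => ?.
  by rewrite subrr add0r mul1r c_ge0' //; lra.
- by have := leq_ltn_trans (leq_trans li ik) kl; rewrite ltnn.
- by rewrite sub0r addNr mul0r.
- have := th_le _ _ ik; have /andP[? ?] := th02pi k => ?.
  by rewrite subrr add0r mul1r c_ge0 //; lra.
Qed.

(** The terms are sorted by argument and their partial sums are the vertices; the vanishing of the
    sum closes the polygon. *)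
Lemma exists_associated_polygon (I : finType) (K : {set I}) (a : I -> nat)
    (z : I -> R[i]) (t : I -> R) :
    (forall j, j \in K -> 0 <= t j < 2 * pi /\ z j = cis (t j)) ->
    \sum_(j in K) (a j)%:R * z j = 0 ->
  exists p : 'I_#|K| -> R[i], associated_polygon a z p.
Proof.
move=> tP sum0; pose le_t := relpre t <=%R.
have le_t_total : total le_t by move=> ? ?; exact: le_total.
have le_t_trans : transitive le_t by move=> ? ? ?; exact: le_trans.
pose s := sort le_t (enum K).
have size_s : size s = #|K| by rewrite size_sort cardE.
have s_uniq : uniq s by rewrite sort_uniq enum_uniq.
have mem_s j : (j \in s) = (j \in K) by rewrite mem_sort mem_enum.
(* The default [enum_val i] is available because an index [i] exists only if [K] is nonempty; [eE]
   allows any other default. *)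
pose e (i : 'I_#|K|) : I := nth (enum_val i) s i.
have eE x0 (i : 'I_#|K|) : e i = nth x0 s i.
  by apply: set_nth_default; rewrite size_s.
have e_inj : injective e.
  move=> i k; rewrite (eE (enum_val i) k) => /eqP.
  by rewrite nth_uniq ?size_s // => /eqP/val_inj.
have eK i : e i \in K by rewrite -mem_s mem_nth ?size_s.
have eP j : (j \in K) = [exists i, e i == j].
  apply/idP/existsP => [|[i /eqP<-] //]; rewrite -mem_s => js.
  have i_lt : (index j s < #|K|)%N by rewrite -size_s index_mem.
  by exists (Ordinal i_lt); rewrite (eE j) /= nth_index.
pose S i := (a (e i))%:R * z (e i).
have S0 : \sum_i S i = 0.
  rewrite -[RHS]sum0 (eq_bigl [in e @: finset.setT]); last first.
    move=> j; rewrite eP; apply/existsP/imsetP => [[i /eqP<-]|[i _ ->]].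
      by exists i; rewrite ?inE.
    by exists i.
  by rewrite big_imset /=; [apply: eq_bigl => i; rewrite finset.in_setT
                           |exact: in2W].
pose p (i : 'I_#|K|) := \sum_(k < #|K| | (k < i)%N) S k.
have sideE i : side p i = S i.
  have pS : \sum_(k < #|K| | (k < i.+1)%N) S k = S i + p i.
    rewrite (bigD1 i) //=; congr (_ + _); apply: eq_bigl => k.
    by rewrite ltnS ltn_neqAle andbC.
  apply/(canLR (addrK _)); rewrite -pS /p /=.
  have := ltn_ord i.
  rewrite leq_eqVlt => /predU1P[iN|iN]; last by rewrite modn_small.
  (* At the last index [ordS] wraps round to the first vertex, an empty sum, which agrees with the
     full sum because the latter is [0]. *)
  rewrite {1}iN modnn big_pred0 // -[LHS]S0; apply: eq_bigl => k.
  by rewrite iN ltn_ord.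
have te_le (i k : 'I_#|K|) : (i <= k)%N -> t (e i) <= t (e k).
  rewrite (eE (enum_val i) i) (eE (enum_val i) k) => ik.
  have le_t_refl : reflexive le_t by move=> ?; exact: lexx.
  have s_sorted : sorted le_t s := sort_sorted le_t_total _.
  apply: (sorted_leq_nth le_t_trans le_t_refl (enum_val i) s_sorted _ _ _ _ ik).
    by rewrite inE size_s.
  by rewrite inE size_s.
exists p, e, (t \o e); split=> //.
- by split=> [i|]; [exact: tP|exact: te_le].
- move=> i; rewrite sideE; split=> //; have [_ ze] := tP _ (eK i).
  by rewrite /S ze norm_cis.
move=> i l; rewrite sideE /p crossBr !cross_sumr.
have SE k : cross (S i) (S k) =
    (a (e i))%:R * (a (e k))%:R * sin (t (e k) - t (e i)).
  by rewrite /S (tP _ (eK i)).2 (tP _ (eK k)).2 cross_cis.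
under [X in X - _]eq_bigr do rewrite SE.
under [X in _ - X]eq_bigr do rewrite SE.
apply: (@partial_sum_sin_ge0 _ (t \o e) (a \o e)) => [k|k k' kk'|].
- by have [] := tP _ (eK k).
- exact: te_le.
under eq_bigr do rewrite -SE.
by rewrite -cross_sumr S0 cross0r.
Qed.
End Polygon.

(** * Removing a common factor from an irreducible vanishing sum *)

Section RescaledSums.
Local Open Scope ring_scope.
Variables (R : realType) (I : finType) (h c : nat) (a b : I -> nat).
Variables (z : I -> R[i]%C) (K : {set I}).

(** Every subsum for [a] is [c] times the one for [b], and [c] is nonzero because the coefficients
    [a j] are positive on the nonempty set [K]. *)
Lemma irreducible_vanishing_sum_scale :
    (forall j, j \in K -> a j = (c * b j)%N) ->
  irreducible_vanishing_sum h a z K -> irreducible_vanishing_sum h b z K.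
Proof.
move=> abE [K0 [a_gt0 zP sumK] irrK].
have sumE (M : {set I}) : M \subset K ->
    \sum_(j in M) (a j)%:R * z j = c%:R * \sum_(j in M) (b j)%:R * z j.
  move=> /fintype.subsetP MK; rewrite mulr_sumr; apply: eq_bigr => j /MK jK.
  by rewrite mulrA -natrM abE.
have cb_gt0 j : j \in K -> (0 < c)%N && (0 < b j)%N.
  by move=> jK; rewrite -muln_gt0 -abE // a_gt0.
have c_neq0 : c%:R != 0 :> R[i]%C.
  by have /set0Pn[j /cb_gt0/andP[]] := K0; rewrite pnatr_eq0 -lt0n.
split=> //.
  split=> // [j /cb_gt0/andP[]//|]; move/eqP: sumK.
  by rewrite sumE // mulf_eq0 (negPf c_neq0) => /eqP.
move=> M MK M0 bM; apply: (irrK M MK M0).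
by rewrite sumE ?bM ?mulr0 // proper_sub.
Qed.

End RescaledSums.

(** * The vanishing sum of a partition, its irreducible subsums and their polygons *)

Local Open Scope ring_scope.

Theorem theorem1 (R : realType) (n : nat) (F : groupType) (x : 'I_n -> F)
    (s : nat) (H : 'I_s -> set F) (alpha : 'I_s -> F)
    (d h_ m : 'I_s -> nat) :
  (2 <= n)%N ->
  freely_generated x ->
  coset_partition H alpha ->
  (forall i, subgroup_index (H i) = d i) ->
  (forall i, (1 < d i)%N) ->
  (forall i j : 'I_s, (i <= j)%N -> (d i <= d j)%N) ->
  (forall i, is_period (transition_matrix x (H i)) (h_ i)) ->
  let h := (\max_(i < s) h_ i)%N in
  (1 < h)%N ->
  let J := [set j : 'I_s | h_ j == h]%SET in
  let omega : R[i] := cis (2 * pi / h%:R) in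
  (forall j, j \in J ->
     is_min_path_length x (H j) (rtranslate (H j) (alpha j)) (m j)) ->
  let z j := omega ^+ m j in
  let coef (K : {set 'I_s}) j := (\prod_(i in K | i != j) d i)%N in
  vanishing_sum h (coef J) z J /\
  let induced (J' : {set 'I_s}) :=
    J' \subset J /\ irreducible_vanishing_sum h (coef J) z J' in
  (exists J', induced J') /\
  (forall J', induced J' ->
    [/\ forall j, j \in J' ->
          coef J j = ((\prod_(i in J :\: J') d i) * coef J' j)%N,
        irreducible_vanishing_sum h (coef J') z J' &
        exists p : 'I_#|J'| -> R[i], associated_polygon (coef J') z p]).
Proof.
move=> n_ge2 freex partH dE d_gt1 _ perH h h_gt1 J omega minm z coef.
have h_gt0 := ltnW h_gt1.
have n_gt0 := ltnW n_ge2.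
have d_gt0 i : (0 < d i)%N := ltnW (d_gt1 i).
have omega_prim : h.-primitive_root omega := cis_primitive_root R h_gt0.
have h_max i : (h_ i <= h)%N := leq_bigmax i.
have wordm i : h_ i = h -> exists2 w, size w = m i &
    rtranslate (H i) (word_prod x w) = rtranslate (H i) (alpha i).
  move=> hi; have iJ : i \in J by rewrite inE hi.
  have [[p [pp lp] <-] _] := minm i iJ.
  exact: path_word pp lp.
have [q [k [q_gt0 qE sum0]]] := partition_character_sum freex partH perH h_gt1
  h_max omega_prim n_gt0 wordm.
have coef_gt0 K j : (0 < coef K j)%N by apply: prodn_cond_gt0.
have zP j : h.-unity_root (z j).
  by rewrite unity_rootE exprAC (prim_expr_order omega_prim) expr1n.
have vanJ : vanishing_sum h (coef J) z J.
  split=> //; have q_neq0 : q%:R != 0 :> R[i] by rewrite pnatr_eq0 -lt0n.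
  (* After multiplication by [q = d j * k j], the factor [d j] completes the product over [J]
     without [j], and this full product comes out of the sum. *)
  apply: (mulfI q_neq0); rewrite mulr0 mulr_sumr.
  transitivity ((\prod_(i in J) d i)%N%:R *
      \sum_(j | h_ j == h) (k j)%:R * omega ^+ m j); last by rewrite sum0 mulr0.
  rewrite mulr_sumr (eq_bigl (fun j => h_ j == h)) => [|j]; last by rewrite inE.
  apply: eq_bigr => j jh; rewrite !mulrA -!natrM; congr (_%:R * _).
  rewrite (bigD1 j) ?inE //= (qE j) dE mulnAC.
  by rewrite (mulnC (d j * _)).
split=> // induced; split.
  (* An irreducible subsum is a minimal nonempty vanishing one, found below [J] itself. *)
  pose P (K : {set 'I_s}) := (K != finset.set0) &&
    (\sum_(j in K) (coef J j)%:R * z j == 0).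
  have PJ : P J.
    rewrite /P; case: vanJ => _ _ ->; rewrite eqxx andbT.
    (* A maximum over no indices would be [0], against [h > 1]; hence the maximum is attained and
       [J] is nonempty. *)
    have s_gt0 : (0 < s)%N.
      rewrite lt0n; apply: contraTneq h_gt1 => s0; rewrite /h big1 // => i _.
      by have := ltn_ord i; rewrite [X in (_ < X)%N]s0.
    have [|i hi] := bigop.eq_bigmax h_; first by rewrite card_ord.
    by apply/set0Pn; exists i; rewrite inE -hi.
  have [K /minsetP[/andP[K0 /eqP sumK] minK] KJ] := minset_exists PJ.
  exists K; split=> //; split=> //.
  move=> M MK M0 sumM; have := minK M; rewrite /P M0 sumM eqxx => /(_ isT).
  by move=> /(_ (proper_sub MK)) eMK; move: MK; rewrite eMK fintype.properxx.
move=> J' [J'J irrJ'].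
have coefE j : j \in J' ->
    coef J j = ((\prod_(i in J :\: J') d i) * coef J' j)%N.
  (* The product splits according to membership in [J']; outside [J'] the condition [i != j] holds
     by itself. *)
  move=> jJ'; rewrite /coef (bigID [in J']) /= mulnC; congr (_ * _)%N.
    apply: eq_bigl => i; rewrite finset.in_setD andbC.
    by have [->|_] := eqVneq i j; rewrite ?jJ' // andbT.
  apply: eq_bigl => i; rewrite andbAC; case: (boolP (i \in J')) => // iJ'.
    by rewrite (fintype.subsetP J'J).
  by rewrite andbF.
have irrJ'' := irreducible_vanishing_sum_scale coefE irrJ'.
split=> //; case: irrJ'' => _ [_ _ sumJ'] _.
(* Reducing [m j] modulo [h] puts the argument in the interval from [0] to [2 * pi] without changing
   the root of unity. *)
apply: (@exists_associated_polygon _ _ _ _ _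
  (fun j => 2 * pi / h%:R * (m j %% h)%N%:R)) => // j _.
split; last by rewrite -cisX prim_expr_mod.
have pi2 : 0 < 2 * pi :> R by rewrite mulr_gt0 ?pi_gt0.
have hR : 0 < h%:R :> R by rewrite ltr0n.
apply/andP; split; first by rewrite mulr_ge0 ?divr_ge0 ?(ltW pi2).
by rewrite mulrAC ltr_pdivrMr // ltr_pM2l // ltr_nat ltn_pmod.
Qed.
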